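(* Let $\mu\in\mathbb{R}$ be the true parameter of the mixed logistic model with crossed random effects described in the context, with responses $y_{ij}$, $1\le i\le m$, $1\le j\le n$. If $(m\wedge n)^{-1}\log(m\vee n)\to 0$ as $m,n\to\infty$, then the maximum likelihood estimator (MLE) of $\mu$ is consistent, i.e., it converges to $\mu$ in probability as $m,n\to\infty$.
   Context: Model. For positive integers $m,n$, let $u_1,\dots,u_m,v_1,\dots,v_n$ be independent $N(0,1)$ random variables (unobserved random effects; their variances are known and equal to $1$). Given $u=(u_i)_{1\le i\le m}$ and $v=(v_j)_{1\le j\le n}$, the binary ($\{0,1\}$-valued) responses $y_{ij}$, $1\le i\le m$, $1\le j\le n$, are conditionally independent with $$\mathrm{logit}\{\mathrm{P}(y_{ij}=1\mid u,v)\}=\mu+u_i+v_j,\qquad \mathrm{logit}(p)=\log\{p/(1-p)\},\ p\in(0,1).$$ The only unknown parameter is $\mu\in\mathbb{R}$. Write $y=(y_{ij})_{1\le i\le m,1\le j\le n}$, and for $\lambda\in\mathbb{R}$ let $p_\lambda(y)$ denote the (marginal, i.e., unconditional on the random effects) probability mass function of $y$ when the true parameter is $\lambda$. The MLE is the (global) maximizer over $\lambda\in\mathbb{R}$ of the likelihood function $\lambda\mapsto p_\lambda(y)$; on data for which no global maximizer exists (such as all $y_{ij}$ equal) its value is arbitrary. Convergence in probability is under the true parameter $\mu$. Notation: $m\wedge n=\min(m,n)$, $m\vee n=\max(m,n)$. *)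

(* Defs.v *)
From HB Require Import structures.
From mathcomp Require Import all_boot all_order all_algebra.
From mathcomp Require Import all_classical all_reals all_analysis.

Set Implicit Arguments.
Unset Strict Implicit.
Unset Printing Implicit Defensive.
Import Order.TTheory GRing.Theory Num.Theory.
Import numFieldNormedType.Exports.
Local Open Scope classical_set_scope.
Local Open Scope ring_scope.

Definition logit (R : realType) (p : R) : R := ln (p / (1 - p)).

(* The sets [A i] may be [setT], so this contains the product rule for every
   subfamily. *)
Definition mutually_independent (d d' : measure_display) (R : realType)
    (T : measurableType d) (T' : measurableType d') (P : probability T R)
    (I : finType) (X : I -> {mfun T >-> T'}) : Prop :=
  forall A : I -> set T', (forall i, measurable (A i)) ->
    P (\bigcap_(i in [set: I]) X i @^-1` A i) =
    (\prod_(i : I) P (X i @^-1` A i))%E.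

Definition sigma_generated (d d' : measure_display)
    (T : measurableType d) (T' : measurableType d')
    (I : Type) (X : I -> {mfun T >-> T'}) : set (set T) :=
  <<s \bigcup_(i in [set: I]) preimage_set_system setT (X i) measurable >>.

(* [g] is a version of the conditional probability P(A | G), where [G] is a
   sub-sigma-algebra of the measurable sets. *)
Definition cond_prob_version (d : measure_display) (R : realType)
    (T : measurableType d) (P : probability T R) (G : set (set T))
    (A : set T) (g : T -> R) : Prop :=
  [/\ forall B : set R, measurable B -> G (g @^-1` B),
      P.-integrable setT (EFin \o g) &
      forall E, G E -> (\int[P]_(w in E) (g w)%:E)%E = P (A `&` E)].

Definition cond_independent (d d' : measure_display) (R : realType)
    (T : measurableType d) (T' : measurableType d') (P : probability T R)
    (G : set (set T)) (I : finType) (X : I -> {mfun T >-> T'}) : Prop :=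
  forall (C : I -> set T') (g : I -> T -> R),
    (forall i, measurable (C i)) ->
    (forall i, cond_prob_version P G (X i @^-1` C i) (g i)) ->
    cond_prob_version P G (\bigcap_(i in [set: I]) X i @^-1` C i)
      (fun w => \prod_(i : I) g i w).

Section crossed_model.
Context (d : measure_display) (R : realType) (T : measurableType d).
Context (m n : nat).

Definition random_effects (u : 'I_m -> {mfun T >-> R})
    (v : 'I_n -> {mfun T >-> R}) (s : 'I_m + 'I_n) : {mfun T >-> R} :=
  match s with inl i => u i | inr j => v j end.

Definition crossed_logistic_model (P : probability T R) (mu : R)
    (u : 'I_m -> {mfun T >-> R}) (v : 'I_n -> {mfun T >-> R})
    (y : 'I_m -> 'I_n -> {mfun T >-> bool}) : Prop :=
  let uv := random_effects u v in
  let G := sigma_generated uv in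
  [/\ forall (s : 'I_m + 'I_n) (A : set R), measurable A ->
        P (uv s @^-1` A) = normal_prob 0 1 A,
      mutually_independent P uv,
      cond_independent P G (fun ij : 'I_m * 'I_n => y ij.1 ij.2) &
      forall i j, exists2 q : T -> R,
        cond_prob_version P G (y i j @^-1` [set true]) q &
        forall w, 0 < q w < 1 /\ logit (q w) = mu + u i w + v j w].

Definition responses (y : 'I_m -> 'I_n -> {mfun T >-> bool}) (w : T) :
    'M[bool]_(m, n) :=
  \matrix_(i, j) y i j w.

Definition response_pmf (P : probability T R)
    (y : 'I_m -> 'I_n -> {mfun T >-> bool}) (b : 'M[bool]_(m, n)) : R :=
  fine (P (responses y @^-1` [set b])).

End crossed_model.

Definition global_maximizer (R : realType) (f : R -> R) (l : R) : Prop :=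
  forall l', f l' <= f l.

(* [p l b] is the likelihood of the parameter [l] at the data [b]. The value
   [est b] is unconstrained when [p ^~ b] has no global maximizer. *)
Definition is_MLE (R : realType) (D : Type) (p : R -> D -> R) (est : D -> R) :
    Prop :=
  forall b, (exists l, global_maximizer (p ^~ b) l) ->
    global_maximizer (p ^~ b) (est b).

(* Convergence in probability to a constant; the [X k] may live on different
   probability spaces. *)
Definition cvg_in_probability (R : realType) (d : nat -> measure_display)
    (T : forall k, measurableType (d k)) (P : forall k, probability (T k) R)
    (X : forall k, T k -> R) (c : R) : Prop :=
  forall eps : R, 0 < eps ->
    (fun k => P k [set w | eps <= `|X k w - c|]) @ \oo --> 0%E.

(* Main.v *)
Require Import Defs.
From HB Require Import structures.
From mathcomp Require Import all_boot all_order all_algebra.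
From mathcomp Require Import all_classical all_reals all_analysis.
From mathcomp Require Import measurable_realfun normal_distribution.
From mathcomp Require Import ring lra.

Set Implicit Arguments.
Unset Strict Implicit.
Unset Printing Implicit Defensive.
Import Order.TTheory GRing.Theory Num.Theory.
Import numFieldNormedType.Exports.
Local Open Scope classical_set_scope.
Local Open Scope ring_scope.

(** The likelihood [p_l(b)] of the crossed model is an [m + n]-dimensional
    integral that does not factor.  Consistency comes from comparing it with the
    likelihood of a subset of the data.  Let [N = min m n] and [K = m * n].  The
    diagonal responses [y_kk], [k < N], share no random effect, so under the
    parameter [l] they are independent Bernoulli variables of parameter [q l], the
    mean of the logistic function at [l + u + v] ([success_prob]), and [q] is
    strictly increasing.

    Let [mu] be the true parameter and [l >= mu + eps].  A test based on the
    diagonal alone tells [mu] from [l] with errors of order [rho ^ N], with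
    [rho < 1] that depends on [mu] and [eps] only, and the likelihood ratio of
    the full data does as well: the probability that [p_mu <= A * p_l] is at most
    [2 * A * rho ^ N] ([prob_likelihood_exceeds]).  This is for one [l] at a time.
    To reach all of them ([prob_exceeds_above]), observe that [ln p_l] is
    [K]-Lipschitz in [l], because each conditional response probability has
    logarithmic derivative at most 1; so up to a factor [expR 1] it suffices to
    look at a grid of mesh [1 / K].  The grid need not extend beyond a distance of
    order [K]: a diagonal response equal to 0 forces [p_l <= 1 - q l], which is at
    most [expR (1 - l)], whereas [p_mu > expR (- 2 * K)] except with probability
    at most [2 ^ K * expR (- 2 * K)], there being [2 ^ K] data sets.  Hence the
    probability that some [l >= mu + eps] does as well as [mu] is at most
    [A * K ^ 2 * r ^ N] with [r < 1].  Parameters [l <= mu - eps] are treated by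
    exchanging 0 and 1.  Outside these events a global maximizer exists and all of
    them are at distance less than [eps] from [mu] ([MLE_near]).  Finally the
    hypothesis on [log (max m n) / min m n] makes [K ^ 2 * r ^ N] tend to 0
    ([rate_dominates]).

    The measure-theoretic part derives the two facts used above from the
    conditional description of the model ([crossed_subset_model]).  The marginal
    likelihood is the mean of a product of logistic weights ([response_pmfE]),
    which may be taken under one and the same law of the random effects for all
    parameters ([response_pmf_change_law]), and the mean of a product of functions
    of independent variables factors ([expectation_prod_independent]). *)

(** * Densities and independence *)

Lemma ge0_integral_mrestr d (T : measurableType d) (R : realType)
    (mu : {measure set T -> \bar R}) (D : set T) (mD : measurable D)
    (f : T -> \bar R) :
  measurable_fun setT f -> (forall x, 0 <= f x)%E ->
  (\int[mrestr mu mD]_x f x = \int[mu]_(x in D) f x)%E.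
Proof.
move=> mf f0.
rewrite [LHS](ge0_negligible_integral (mu := mrestr mu mD) (N := ~` D))//.
- rewrite setDE setCK setTI; apply: eq_measure_integral => A mA AD.
  by rewrite /mrestr /=; congr (mu _); apply: setIidl.
- exact: measurableC.
- by change (mu (~` D `&` D) = 0%E); rewrite setICl measure0.
Qed.

(** The image under [Z] of the measure with density [W], with its change of
    variables formula.  It is realised as the image of the product of [mu] and
    Lebesgue measure, restricted to the region under the graph of [W], so that
    Tonelli's theorem gives the formula for every nonnegative [f] at once. *)
Lemma exists_image_density d d' (T : measurableType d) (U : measurableType d')
    (R : realType) (mu : {sigma_finite_measure set T -> \bar R})
    (Z : T -> U) (W : T -> R) :
  measurable_fun setT Z -> measurable_fun setT W -> (forall w, 0 <= W w) ->
  exists eta : {measure set U -> \bar R},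
    forall f, measurable_fun setT f -> (forall z, 0 <= f z)%E ->
    (\int[eta]_z f z = \int[mu]_w (f (Z w) * (W w)%:E))%E.
Proof.
move=> mZ mW W0.
pose S := [set p : T * R | 0 <= p.2] `&` [set p : T * R | p.2 < W p.1].
have mS : measurable S.
  have m2 : measurable_fun setT (@snd T R) by exact: measurable_snd.
  have mW1 : measurable_fun setT (W \o @fst T R).
    by apply: measurableT_comp => //; exact: measurable_fst.
  rewrite -[S]setTI setIIr; apply: measurableI.
    have m0 : measurable_fun setT (fun _ : T * R => 0 : R) by exact: measurable_cst.
    by have /(_ measurableT [set true]) := measurable_fun_ler m0 m2; exact.
  by have /(_ measurableT [set true]) := measurable_fun_ltr m2 mW1; exact.
have mZ1 : measurable_fun setT (Z \o @fst T R).
  by apply: measurableT_comp => //; exact: measurable_fst.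
pose m := (mu \x @lebesgue_measure R)%E.
pose mZm := isMeasurableFun.Build _ _ _ _ _ mZ1.
pose Zm : {mfun _ >-> _} := HB.pack (Z \o @fst T R) mZm.
exists (pushforward (mrestr m mS) Zm) => f mf f0.
rewrite ge0_integral_pushforward//=.
rewrite preimage_setT ge0_integral_mrestr//; last first.
  by apply: measurableT_comp.
rewrite integral_mkcond fubini_tonelli1//=; last 2 first.
- apply/(measurable_restrictT _ _).1 => //.
  by apply: measurable_funTS; apply: measurableT_comp.
- by move=> x; rewrite patchE; case: ifP.
apply: eq_integral => w _; rewrite /fubini_F/=.
transitivity (\int[@lebesgue_measure R]_(t in `[0%R, W w[%classic) f (Z w))%E.
  rewrite [RHS]integral_mkcond; apply: eq_integral => t _.
  rewrite !patchE (_ : _ \in S = (t \in `[0, W w[%classic))//.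
  apply/idP/idP; rewrite !inE /S /= in_itv /=; first by move=> [-> ->].
  by move=> /andP[-> ->].
rewrite integral_cst//= lebesgue_measure_itv/= lte_fin; case: ltP => h.
  by rewrite sube0.
by congr (_ * _%:E)%E; apply/eqP; rewrite eq_le h W0.
Unshelve. exact: mZ1.
Qed.

Section independence.
Context (d d' : measure_display) (T : measurableType d) (U : measurableType d').
Context (R : realType) (P : probability T R) (kappa : probability U R).
Context (C : set (set U)) (I : finType) (X : I -> T -> U).
Hypothesis measurable_gen : measurable = <<s C >>.
Hypothesis CI : setI_closed C.
Hypothesis CT : C setT.
Hypothesis mX : forall i, measurable_fun setT (X i).
Hypothesis X_indep : forall A : I -> set U, (forall i, C (A i)) ->
  P (\bigcap_(i in [set: I]) X i @^-1` A i) = (\prod_i kappa (A i))%E.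

Let mC A : C A -> measurable A.
Proof. by rewrite measurable_gen; exact: sub_sigma_algebra. Qed.

(* [s] lists the indices where [psi i] is arbitrary; elsewhere it is still the
   indicator of a member of [C]. *)
Let expectation_prod_seq (s : seq I) (psi : I -> U -> R) (a : I -> R) :
  (forall i, measurable_fun setT (psi i)) -> (forall i z, 0 <= psi i z) ->
  (forall i, (\int[kappa]_z (psi i z)%:E)%E = (a i)%:E) ->
  (forall i, i \notin s -> exists2 A, C A & psi i = \1_A) ->
  (\int[P]_w (\prod_i psi i (X i w))%:E)%E = (\prod_i a i)%:E.
Proof.
elim: s psi a => [|i0 s IH] psi a mpsi psi0 psia psiC.
  have [A CA] : {A : I -> set U & forall i, C (A i) /\ psi i = \1_(A i)}.
    apply: (@choice I (set U) (fun i A => C A /\ psi i = \1_A)) => i.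
    by have [//|A] := psiC i; exists A.
  transitivity (\int[P]_w (\1_(\bigcap_(i in [set: I]) X i @^-1` A i) w)%:E)%E.
    apply: eq_integral => w _; congr (_%:E).
    rewrite indicE; have [|] := boolP (_ \in _) => hw.
      rewrite big1// => i _; rewrite (CA i).2 indicE mem_set//.
      by move: hw; rewrite inE; exact.
    have [i Xi] : exists i, ~ A i (X i w).
      apply/existsNP => h; move/negP: hw; apply; rewrite inE => i _; exact: h.
    by rewrite (bigD1 i)//= (CA i).2 indicE memNset// mul0r.
  rewrite integral_indic//; last first.
    apply: fin_bigcap_measurable => // i _.
    by rewrite -[X in measurable X]setTI; apply: mX => //; apply: mC; exact: (CA i).1.
  rewrite setIT; apply: (etrans (X_indep (fun i => (CA i).1))).
  rewrite -prodEFin; apply: eq_bigr => i _.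
  rewrite -psia (CA i).2 integral_indic ?setIT//.
  by apply: mC; exact: (CA i).1.
(* As functions of the set [A], the expectation of [W \1_A(X i0)] and the
   product of [kappa A] by a constant are finite measures that agree on the
   pi-system [C], by the induction hypothesis; hence they are equal, and can be
   integrated against [psi i0]. *)
pose W w := \prod_(i | i != i0) psi i (X i w).
have mW : measurable_fun setT W.
  rewrite /W; under eq_fun do rewrite -big_filter.
  by apply: measurable_prod => i _; exact: measurableT_comp.
have W0 w : 0 <= W w by apply: prodr_ge0.
have [eta etaE] := exists_image_density P (mX i0) mW W0.
have a0 i : 0 <= a i.
  by rewrite -lee_fin -psia integral_ge0// => z _; rewrite lee_fin.
have c0 : 0 <= \prod_(i | i != i0) a i by exact: prodr_ge0.
pose c := NngNum c0.
have etaC A : C A -> eta A = mscale c kappa A.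
  move=> CA; have mA := mC CA.
  have -> : eta A = (\int[eta]_z (\1_A z)%:E)%E by rewrite integral_indic ?setIT.
  rewrite etaE//; last first.
    exact/measurable_EFinP.
  pose psi' i := if i == i0 then \1_A else psi i.
  pose a' i := if i == i0 then fine (kappa A) else a i.
  transitivity (\int[P]_w (\prod_i psi' i (X i w))%:E)%E.
    apply: eq_integral => w _; rewrite (bigD1 i0)//= /psi' eqxx -EFinM.
    by congr (_ * _)%:E; apply: eq_bigr => i /negPf ->.
  rewrite (IH psi' a'); first last.
  - move=> i; rewrite /psi'; case: eqP => [_ _|/eqP ii0 is_]; first by exists A.
    by apply: psiC; rewrite inE negb_or ii0.
  - move=> i; rewrite /psi' /a'; case: eqP => // _.
    by rewrite integral_indic// setIT fineK// fin_num_measure.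
  - by move=> i z; rewrite /psi'; case: eqP.
  - by move=> i; rewrite /psi'; case: eqP.
  rewrite (bigD1 i0)//= /a' eqxx EFinM fineK ?fin_num_measure// muleC.
  congr (_%:E * _)%E.
  by apply: eq_bigr => i /negPf ->.
have etaM A : measurable A -> eta A = mscale c kappa A.
  apply: (measure_unique C (fun=> setT)) => //.
    by rewrite bigcup_const//; exists 0%N.
  move=> _; rewrite etaC// /mscale/= probability_setT mule1; exact: ltry.
transitivity (\int[eta]_z (psi i0 z)%:E)%E.
  rewrite etaE; [|exact/measurable_EFinP|by move=> z; rewrite lee_fin].
  by apply: eq_integral => w _; rewrite (bigD1 i0)//= EFinM.
rewrite (eq_measure_integral (mscale c kappa)); last by move=> A mA _; exact: etaM.
rewrite ge0_integral_mscale//; last 2 first.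
- exact/measurable_EFinP.
- by move=> z _; rewrite lee_fin.
by rewrite psia (bigD1 i0)//= mulrC EFinM.
Qed.

(** Independence on a generating pi-system extends to expectations of products.
    The indicators are replaced by general functions one index at a time. *)
Lemma expectation_prod_independent (psi : I -> U -> R) (a : I -> R) :
  (forall i, measurable_fun setT (psi i)) -> (forall i z, 0 <= psi i z) ->
  (forall i, (\int[kappa]_z (psi i z)%:E)%E = (a i)%:E) ->
  (\int[P]_w (\prod_i psi i (X i w))%:E)%E = (\prod_i a i)%:E.
Proof.
move=> mpsi psi0 psia; apply: (@expectation_prod_seq (enum I)) => // i.
by rewrite mem_enum.
Qed.

End independence.

(** * The logistic function and the law of a single response *)

Section expit.
Context (R : realType).
Implicit Types (z : R) (c : bool).

Definition expit z : R := (1 + expR (- z))^-1.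

Lemma expit_gt0 z : 0 < expit z.
Proof. by rewrite invr_gt0 addr_gt0// expR_gt0. Qed.

Lemma expit_lt1 z : expit z < 1.
Proof. by rewrite invf_lt1 ?addr_gt0 ?expR_gt0// ltrDl expR_gt0. Qed.

Lemma expitN z : expit (- z) = 1 - expit z.
Proof.
have e0 := expR_gt0 z.
by rewrite /expit opprK expRN; field; rewrite !gt_eqF// addr_gt0.
Qed.

Lemma logitK (q z : R) : 0 < q < 1 -> logit q = z -> q = expit z.
Proof.
move=> /andP[q0 q1] <-; have q1' : 0 < 1 - q by rewrite subr_gt0.
rewrite /expit expRN lnK ?posrE ?divr_gt0//.
by field; rewrite !gt_eqF//= addrC subrK ltr01.
Qed.

Lemma ltr_expit z z' : z < z' -> expit z < expit z'.
Proof.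
move=> zz'; rewrite ltf_pV2 ?posrE ?addr_gt0 ?expR_gt0//.
by rewrite ltrD2l ltr_expR ltrN2.
Qed.

Lemma expit_le_expR z : expit z <= expR z.
Proof.
rewrite -[leRHS]invrK -expRN lef_pV2 ?posrE ?addr_gt0 ?expR_gt0//.
by rewrite lerDr.
Qed.

(** The logarithmic derivative of [expit] lies between 0 and 1. *)
Lemma expit_le_shift z z' : expit z' <= expR `|z' - z| * expit z.
Proof.
rewrite mulrC ler_pdivlMl ?addr_gt0 ?expR_gt0// -ler_pdivlMr ?expit_gt0//.
rewrite /expit invrK mulrDr mulr1 lerD//.
  by rewrite -expR0 ler_expR.
by rewrite -expRD ler_expR -lerBlDr opprK addrC ler_norm.
Qed.

Lemma measurable_expit : measurable_fun setT expit.
Proof.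
apply: continuous_measurable_fun => z.
apply: (@cvgV _ _ _ _ (fun z => 1 + expR (- z)) (1 + expR (- z))).
  by rewrite gt_eqF// addr_gt0// expR_gt0.
apply: cvgD; first exact: cvg_cst.
apply: (cvg_comp _ expR); last exact: continuous_expR.
by apply: (@cvgN _ R^o); exact: cvg_id.
Qed.

End expit.

Section normal_pair.
Context (R : realType).

(** The standard normal law on [R] with its canonical measurable structure, so
    that products such as [normal_pair] live on [R * R]. *)
Definition std_normal : set R -> \bar R := @normal_prob R 0 1.

Let std_normal0 : std_normal set0 = 0%E. Proof. exact: measure0. Qed.

Let std_normal_ge0 A : (0 <= std_normal A)%E.
Proof. exact: (measure_ge0 (@normal_prob R 0 1)). Qed.

Let std_normal_sigma_additive : semi_sigma_additive std_normal.
Proof. exact: (@measure_semi_sigma_additive _ _ _ (@normal_prob R 0 1)). Qed.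

Let std_normal_setT : std_normal setT = 1%E.
Proof. exact: (@probability_setT _ _ _ (@normal_prob R 0 1)). Qed.

HB.instance Definition _ := isMeasure.Build _ _ _
  std_normal std_normal0 std_normal_ge0 std_normal_sigma_additive.
HB.instance Definition _ :=
  @Measure_isProbability.Build _ _ _ std_normal std_normal_setT.

Definition normal_pair := (std_normal \x std_normal)%E.

HB.instance Definition _ := Measure.on normal_pair.

Let normal_pair_setT : normal_pair setT = 1%E.
Proof.
by rewrite -setXTT [LHS]product_measure1E//= std_normal_setT mule1.
Qed.

HB.instance Definition _ :=
  @Measure_isProbability.Build _ _ _ normal_pair normal_pair_setT.

Lemma normal_mgf (s : R) :
  (\int[std_normal]_x (expR (s * x))%:E = (expR (s ^+ 2 / 2))%:E)%E.
Proof.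
have ms : measurable_fun setT (fun x : R => (expR (s * x))%:E).
  apply/measurable_EFinP; apply: measurableT_comp => //.
have [eta etaE] := @exists_image_density _ _ _ _ R lebesgue_measure
  (idfun : R -> R) (normal_pdf 0 1) (@measurable_id _ _ _)
  (measurable_normal_pdf 0 1) (normal_pdf_ge0 0 1).
rewrite (eq_measure_integral eta); last first.
  move=> A mA _; transitivity (\int[eta]_x (\1_A x)%:E)%E; last first.
    by rewrite integral_indic// setIT.
  rewrite etaE//; last exact/measurable_EFinP.
  transitivity (\int[lebesgue_measure]_(x in A) (normal_pdf 0 1 x)%:E)%E => //.
  rewrite [LHS]integral_mkcond; apply: eq_integral => x _ /=.
  by rewrite patchE indicE; case: (x \in A); rewrite ?mul1e ?mul0e.
rewrite etaE//.
(* Completing the square turns the tilted density into that of N(s, 1). *)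
transitivity (\int[lebesgue_measure]_x
   ((expR (s ^+ 2 / 2))%:E * (normal_pdf s 1 x)%:E))%E.
  apply: eq_integral => x _; rewrite -!EFinM; congr (_%:E).
  rewrite !normal_pdfE// /normal_fun mulrCA [RHS]mulrCA -!expRD.
  congr (_ * expR _).
  by rewrite /=; field.
rewrite ge0_integralZl//; last by move=> x _; rewrite lee_fin normal_pdf_ge0.
  by rewrite integral_normal_pdf mule1.
apply/measurable_EFinP; exact: measurable_normal_pdf.
Qed.

Lemma normal_pair_mgf (s : R) :
  (\int[normal_pair]_z (expR (s * (z.1 + z.2)))%:E = (expR (s ^+ 2))%:E)%E.
Proof.
have mf : measurable_fun setT (fun z : R * R => (expR (s * (z.1 + z.2)))%:E).
  apply/measurable_EFinP; apply: measurableT_comp => //.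
  by apply: measurable_funM => //; apply: measurable_funD.
rewrite [LHS](fubini_tonelli1 (m1 := std_normal) (m2 := std_normal))//.
transitivity (\int[std_normal]_x ((expR (s ^+ 2 / 2))%:E * (expR (s * x))%:E))%E.
  apply: eq_integral => x _; rewrite /fubini_F/= muleC -normal_mgf.
  rewrite -ge0_integralZl//; last first.
    by apply/measurable_EFinP; apply: measurableT_comp => //.
  by apply: eq_integral => y _; rewrite mulrDr expRD EFinM.
rewrite ge0_integralZl//; last first.
  by apply/measurable_EFinP; apply: measurableT_comp => //.
by rewrite normal_mgf -EFinM -expRD -splitr.
Qed.

End normal_pair.

Section success_prob.
Context (R : realType).
Implicit Types (l : R) (z : R * R).

Local Notation kappa := (@normal_pair R).

(** The marginal probability that a single response equals 1. *)
Definition success_prob l : R :=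
  fine (\int[kappa]_z (expit (l + z.1 + z.2))%:E)%E.

Lemma measurable_expit_shift l :
  measurable_fun setT (fun z : R * R => expit (l + z.1 + z.2)).
Proof.
apply: measurableT_comp; first exact: measurable_expit.
by apply: measurable_funD => //; apply: measurable_funD.
Qed.

Let mE l : measurable_fun setT (fun z : R * R => (expit (l + z.1 + z.2))%:E).
Proof. by apply/measurable_EFinP; exact: measurable_expit_shift. Qed.

Let mE' l : measurable_fun setT
  (fun z : R * R => (1 - expit (l + z.1 + z.2))%:E).
Proof.
apply/measurable_EFinP; apply: measurable_funB => //.
exact: measurable_expit_shift.
Qed.

Let E0 l z : (0 <= (expit (l + z.1 + z.2))%:E)%E.
Proof. by rewrite lee_fin ltW// expit_gt0. Qed.

Let E'0 l z : (0 <= (1 - expit (l + z.1 + z.2))%:E)%E.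
Proof. by rewrite lee_fin subr_ge0 ltW// expit_lt1. Qed.

Let integral1 : (\int[kappa]_z 1%:E = 1)%E.
Proof. by rewrite integral_cst// mul1e; exact: (@probability_setT _ _ _ kappa). Qed.

Lemma success_probE l :
  (\int[kappa]_z (expit (l + z.1 + z.2))%:E = (success_prob l)%:E)%E.
Proof.
rewrite fineK// ge0_fin_numE; last by apply: integral_ge0.
apply: (@le_lt_trans _ _ (\int[kappa]_z 1%:E)%E); last by rewrite integral1 ltry.
by apply: ge0_le_integral => // z _; rewrite lee_fin ltW// expit_lt1.
Qed.

Lemma failure_probE l :
  (\int[kappa]_z (1 - expit (l + z.1 + z.2))%:E = (1 - success_prob l)%:E)%E.
Proof.
have : (\int[kappa]_z ((expit (l + z.1 + z.2))%:E +
                       (1 - expit (l + z.1 + z.2))%:E) = 1)%E.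
  by rewrite -[RHS]integral1; apply: eq_integral => z _; rewrite -EFinD subrKC.
rewrite ge0_integralD// success_probE EFinB => <-.
by rewrite addeAC subee// add0e.
Qed.

Lemma success_prob_ge0 l : 0 <= success_prob l.
Proof. by rewrite -lee_fin -success_probE; exact: integral_ge0. Qed.

Lemma success_prob_le1 l : success_prob l <= 1.
Proof. by rewrite -subr_ge0 -lee_fin -failure_probE; exact: integral_ge0. Qed.

Lemma integral_response_weight l (a b : R) : 0 <= a -> 0 <= b ->
  (\int[kappa]_z (expit (l + z.1 + z.2) * a +
                  (1 - expit (l + z.1 + z.2)) * b)%:E =
   (success_prob l * a + (1 - success_prob l) * b)%:E)%E.
Proof.
move=> a0 b0.
under eq_integral do rewrite EFinD !EFinM.
rewrite ge0_integralD//.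
- rewrite ge0_integralZr// ge0_integralZr//.
  by rewrite success_probE failure_probE.
- by move=> z _; rewrite mule_ge0.
- exact: emeasurable_funM.
- by move=> z _; rewrite mule_ge0.
- exact: emeasurable_funM.
Qed.

Lemma ltr_success_prob l l' : l < l' -> success_prob l < success_prob l'.
Proof.
move=> ll'.
have D0 z : expit (l + z.1 + z.2) < expit (l' + z.1 + z.2).
  by apply: ltr_expit; rewrite !ltrD2r.
have mD : measurable_fun setT (fun z : R * R =>
    (expit (l' + z.1 + z.2) - expit (l + z.1 + z.2))%:E).
  by apply/measurable_EFinP; apply: measurable_funB; exact: measurable_expit_shift.
have DE : (\int[kappa]_z (expit (l' + z.1 + z.2) - expit (l + z.1 + z.2))%:E =
    (success_prob l' - success_prob l)%:E)%E.
  have : (\int[kappa]_z ((expit (l + z.1 + z.2))%:E +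
    (expit (l' + z.1 + z.2) - expit (l + z.1 + z.2))%:E) =
    (success_prob l')%:E)%E.
    by rewrite -success_probE; apply: eq_integral => z _; rewrite -EFinD subrKC.
  rewrite ge0_integralD//; last by move=> z _; rewrite lee_fin subr_ge0 ltW.
  by rewrite success_probE EFinB => <-; rewrite addeAC subee// add0e.
rewrite -subr_gt0 lt_neqAle -lee_fin -DE integral_ge0 ?andbT; last first.
  by move=> z _; rewrite lee_fin subr_ge0 ltW.
apply/negP => /eqP D00.
(* A strictly positive function whose integral vanishes would be zero almost
   everywhere, which is absurd for a probability. *)
have : (\int[kappa]_z `|(expit (l' + z.1 + z.2) - expit (l + z.1 + z.2))%:E| = 0)%E.
  rewrite -[RHS]/(0%:E) D00 -DE; apply: eq_integral => z _.
  by rewrite gee0_abs// lee_fin subr_ge0 ltW.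
move/(ae_eq_integral_abs kappa measurableT mD) => [N [mN N0 sN]].
have : kappa setT = 0%E.
  apply: (subset_measure0 (B := N)) => // z _; apply: sN => /= /(_ I).
  by move=> [] /eqP; rewrite subr_eq0 gt_eqF.
rewrite [LHS](@probability_setT _ _ _ kappa) => /eqP.
by rewrite onee_eq0.
Qed.

(** The logistic function is below the exponential, and the sum of two normal
    variables has an exponential moment. *)
Lemma success_prob_le_expR l : success_prob l <= expR 1 * expR l.
Proof.
rewrite -lee_fin -success_probE.
apply: (@le_trans _ _ (\int[kappa]_z ((expR l)%:E * (expR (1 * (z.1 + z.2)))%:E))%E).
  apply: ge0_le_integral => //.
    apply: emeasurable_funM => //; apply/measurable_EFinP.
    apply: measurableT_comp => //; apply: measurable_funM => //.
    exact: measurable_funD.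
  move=> z _; rewrite -EFinM lee_fin -expRD mul1r addrA; exact: expit_le_expR.
rewrite ge0_integralZl//; last first.
  apply/measurable_EFinP.
  apply: measurableT_comp => //; apply: measurable_funM => //.
  exact: measurable_funD.
by rewrite normal_pair_mgf expr1n -EFinM mulrC.
Qed.

Lemma failure_prob_le_expR l : 1 - success_prob l <= expR 1 * expR (- l).
Proof.
rewrite -lee_fin -failure_probE.
apply: (@le_trans _ _ (\int[kappa]_z ((expR (- l))%:E * (expR (-1 * (z.1 + z.2)))%:E))%E).
  apply: ge0_le_integral => //.
    apply: emeasurable_funM => //; apply/measurable_EFinP.
    apply: measurableT_comp => //; apply: measurable_funM => //.
    exact: measurable_funD.
  move=> z _; rewrite -EFinM lee_fin -expRD mulN1r -opprD addrA -expitN.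
  exact: expit_le_expR.
rewrite ge0_integralZl//; last first.
  apply/measurable_EFinP.
  apply: measurableT_comp => //; apply: measurable_funM => //.
  exact: measurable_funD.
by rewrite normal_pair_mgf sqrrN expr1n -EFinM mulrC.
Qed.

End success_prob.

(** * The subset argument *)

(** Obtained by inverting [1 - z <= expR (- z)]. *)
Lemma expR_le_quadratic (R : realType) (z : R) :
  z <= 1 / 2 -> expR z <= 1 + z + 2 * z ^+ 2.
Proof.
move=> z2; have z1 : 0 < 1 - z by lra.
have : 1 - z <= expR (- z) by exact: expR_ge1Dx.
rewrite expRN -[leLHS]invrK lef_pV2 ?posrE ?invr_gt0 ?expR_gt0// => /le_trans; apply.
by rewrite -div1r ler_pdivrMr//; nra.
Qed.

Section subset_model.
Context (R : realType) (D : finType) (N K : nat).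
Context (x : D -> 'I_N -> bool) (q : R -> R) (p : R -> D -> R).

(** What the subset argument uses of the likelihood [p l b] of the parameter [l]
    on the finite sample space [D].  A subset [x b] of [N] of the observations
    is made of independent Bernoulli([q l]) variables: this is [likelihood_weight],
    in terms of expectations of products.  About the remaining data nothing is
    known but [likelihood_shift]: the log-likelihood is [K]-Lipschitz, [K] being
    the total number of observations. *)
Record subset_model : Prop := SubsetModel {
  likelihood_ge0 : forall l b, 0 <= p l b ;
  likelihood_shift : forall l l' b, p l' b <= expR (K%:R * `|l' - l|) * p l b ;
  likelihood_weight : forall l (phi : 'I_N -> bool -> R), (forall i c, 0 <= phi i c) ->
    \sum_b p l b * \prod_i phi i (x b i) =
    \prod_i (q l * phi i true + (1 - q l) * phi i false) }.

Hypothesis q01 : forall l, 0 <= q l <= 1.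
Hypothesis M : subset_model.

Let p0 := likelihood_ge0 M.

(** The event that the [i]-th observation is a failure contains [b]. *)
Lemma likelihood_le_failure l b i : x b i = false -> p l b <= 1 - q l.
Proof.
move=> xbi; pose phi j c : R := if j == i then (~~ c)%:R else 1.
have <- : \sum_b p l b * \prod_j phi j (x b j) = 1 - q l.
  rewrite (likelihood_weight M); last first.
    by move=> j c; rewrite /phi; case: ifP => // _; rewrite ler0n.
  rewrite (bigD1 i)//= big1 => [|j /negPf ji].
    by rewrite /phi eqxx/= mulr0 add0r !mulr1.
  by rewrite /phi ji !mulr1 subrKC.
rewrite (bigD1 b)//= big1 => [|j _]; last first.
  by rewrite /phi; case: eqP => // ->; rewrite xbi.
rewrite mulr1 lerDl sumr_ge0// => b' _; rewrite mulr_ge0// prodr_ge0// => j _.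
by rewrite /phi; case: ifP => // _; rewrite ler0n.
Qed.

Lemma prob_all_success l : \sum_(b | [forall i, x b i]) p l b = q l ^+ N.
Proof.
have /esym := likelihood_weight M l (phi := fun _ c => c%:R) (fun _ c => ler0n _ c).
under eq_bigr do rewrite mulr1 mulr0 addr0.
rewrite prodr_const card_ord => ->.
rewrite [LHS]big_mkcond; apply: eq_bigr => b _; case: ifPn => [/forallP h|].
  by rewrite big1 ?mulr1// => i _; rewrite h.
rewrite negb_forall => /existsP[i /negPf xi].
by rewrite (bigD1 i)//= xi mul0r mulr0.
Qed.

(** Data of small likelihood are unlikely, since there are only [#|D|] of them. *)
Lemma prob_small_likelihood l t : 0 <= t ->
  \sum_(b | p l b <= t) p l b <= #|D|%:R * t.
Proof.
move=> t0; rewrite -sum1_card natr_sum mulr_suml.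
rewrite [leLHS]big_mkcond; apply: ler_sum => b _; rewrite mul1r.
by case: ifP.
Qed.

(** The subset argument: the likelihood ratio of the full data cannot
    discriminate between [l] and [l'] worse than a test based on the subset.
    Let [X b] be a positive function of the subset [x b].  On the event where
    [p l b <= A * p l' b], the mass [p l b] is at most [A * p l b * X b] if
    [1 <= X b], and at most [A * p l' b / X b] otherwise, so its probability is
    at most [A] times the sum of the expectations of [X] under [l] and of [1 / X]
    under [l'].  Both depend on the subset alone and are exponentially small when
    [X] is the exponential of the excess of the successes over their threshold. *)
Lemma prob_likelihood_exceeds l l' delta A : 0 < delta <= 1 ->
  q l + 2 * delta <= q l' -> 1 <= A ->
  \sum_(b | p l b <= A * p l' b) p l b <= 2 * A * (1 - delta ^+ 2 / 8) ^+ N.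
Proof.
move=> /andP[d0 d1] dq A1.
have /andP[ql0 ql1] := q01 l; have /andP[ql'0 ql'1] := q01 l'.
(* The threshold [a] is at least [delta] above [q l] and below [q l']; the tilt
   [t] minimises the quadratic bound [1 - t * delta + 2 * t ^+ 2]. *)
have [t tE] : exists t, t = delta / 4 by exists (delta / 4).
have t0 : 0 <= t by lra.
pose a := q l + delta.
pose phi (s : R) (c : bool) := expR (s * t * (c%:R - a)).
pose X s b := \prod_(i < N) phi s (x b i).
have X0 s b : 0 < X s b by apply: prodr_gt0 => i _; exact: expR_gt0.
have XV b : X (-1) b = (X 1 b)^-1.
  rewrite /X -prodfV; apply: eq_bigr => i _.
  by rewrite /phi -expRN; congr expR; ring.
have EX s l1 : \sum_b p l1 b * X s b =
    (q l1 * phi s true + (1 - q l1) * phi s false) ^+ N.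
  rewrite -[N in RHS]card_ord -prodr_const.
  by apply: (likelihood_weight M l1 (phi := fun _ => phi s)) => i c; exact: expR_ge0.
have phiT s : s ^+ 2 = 1 -> `|s| <= 1 -> forall c : bool, phi s c <=
    1 + s * t * (c%:R - a) + 2 * t ^+ 2.
  move=> s2 s1 c.
  have ca : `|c%:R - a| <= 1.
    by rewrite /a ler_norml; case: c; apply/andP; split; rewrite /=; lra.
  apply: (le_trans (expR_le_quadratic _)).
    apply: (le_trans (ler_norm _)); rewrite !normrM (ger0_norm t0).
    have -> : 1 / 2 = 1 * (1 / 2) * 1 :> R by ring.
    apply: ler_pM => //; first by rewrite mulr_ge0.
    by apply: ler_pM => //; lra.
  rewrite lerD2l ler_pM2l// !exprMn s2 mul1r ler_piMr ?sqr_ge0//.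
  by rewrite -real_normK ?num_real// expr_le1.
have A0 : 0 <= A by lra.
have X0' s b : 0 <= X s b by exact: ltW.
have rho0 : 0 <= 1 - delta ^+ 2 / 8 by nra.
(* Chernoff's bound, for [l] and upwards with [s = 1], for [l'] and downwards
   with [s = -1]. *)
have bound l1 s : s ^+ 2 = 1 -> `|s| <= 1 -> 0 <= q l1 <= 1 ->
    s * (q l1 - a) <= - delta ->
    \sum_b p l1 b * X s b <= (1 - delta ^+ 2 / 8) ^+ N.
  move=> s2 s1 /andP[h0 h1] hs; rewrite EX lerXn2r ?nnegrE//.
    by rewrite addr_ge0// mulr_ge0 ?expR_ge0// subr_ge0.
  have /(ler_wpM2l h0) hT := phiT s s2 s1 true.
  have h1' : 0 <= 1 - q l1 by lra.
  have /(ler_wpM2l h1') hF := phiT s s2 s1 false.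
  apply: (le_trans (lerD hT hF)).
  have -> : q l1 * (1 + s * t * (true%:R - a) + 2 * t ^+ 2) +
    (1 - q l1) * (1 + s * t * (false%:R - a) + 2 * t ^+ 2) =
    1 + t * (s * (q l1 - a)) + 2 * t ^+ 2 by rewrite /=; ring.
  have : t * (s * (q l1 - a)) <= t * - delta by rewrite ler_wpM2l.
  by rewrite tE; nra.
have B1 := bound l 1 (expr1n _ _) _ (q01 l).
have B2 := bound l' (-1) _ _ (q01 l').
apply: (@le_trans _ _ (\sum_b A * (p l b * X 1 b + p l' b * X (-1) b))).
  rewrite [leLHS]big_mkcond; apply: ler_sum => b _; case: ifP => [h|_]; last first.
    by rewrite mulr_ge0// addr_ge0// mulr_ge0.
  have q0 := p0 l b; have q0' := p0 l' b.
  rewrite mulrDr; have [X1|X1] := leP 1 (X 1 b).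
    rewrite -[leLHS]addr0 lerD//; last by rewrite !mulr_ge0.
    rewrite -[leLHS]mul1r ler_pM ?mul1r// ?ler_peMr//.
  rewrite -[leLHS]add0r lerD//; first by rewrite !mulr_ge0.
  apply: (le_trans h); rewrite ler_wpM2l//.
  by rewrite ler_peMr// XV invf_ge1 ?ltW.
rewrite -mulr_sumr big_split/= [2 * A]mulrC -mulrA ler_wpM2l//.
rewrite mulr_natl mulr2n lerD//.
  by apply: B1; rewrite ?normr1// mul1r /a; lra.
by apply: B2; rewrite ?sqrrN ?expr1n// ?normrN1// mulN1r /a; lra.
Qed.

End subset_model.

Definition exceeds_above (R : realType) (D : finType) (p : R -> D -> R)
    (mu eps : R) (b : D) : bool :=
  `[< exists2 l, mu + eps <= l & p mu b <= p l b >].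

Lemma sum_le_union (R : realType) (D J : finType) (f : D -> R)
    (E E1 E2 : pred D) (E3 : J -> pred D) :
  (forall b, 0 <= f b) ->
  (forall b, E b -> [|| E1 b, E2 b | [exists j, E3 j b]]) ->
  \sum_(b | E b) f b <= \sum_(b | E1 b) f b + \sum_(b | E2 b) f b +
                        \sum_j \sum_(b | E3 j b) f b.
Proof.
move=> f0 EE; pose g (E : pred D) b := if E b then f b else 0.
apply: (@le_trans _ _ (\sum_b (g E1 b + g E2 b + \sum_j g (E3 j) b))); last first.
  rewrite !big_split/= -!big_mkcond exchange_big lerD2l.
  by apply: ler_sum => j _; rewrite -big_mkcond.
rewrite big_mkcond; apply: ler_sum => b _; rewrite /g.
have S0 : 0 <= \sum_j (if E3 j b then f b else 0).
  by apply: sumr_ge0 => j _; case: ifP.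
have I0 (c : bool) : 0 <= (if c then f b else 0) by case: c.
case: ifP => [/EE|_]; last by rewrite !addr_ge0.
case/or3P => [->|->|/existsP[j Ej]].
- by rewrite -addrA lerDl addr_ge0.
- by rewrite addrAC lerDr addr_ge0.
- apply: (@le_trans _ _ (\sum_j (if E3 j b then f b else 0))).
    rewrite (bigD1 j)//= Ej lerDl sumr_ge0// => k _; exact: I0.
  by rewrite lerDr addr_ge0.
Qed.

Section tail.
Context (R : realType) (q : R -> R) (C mu eps : R).
Hypothesis q01 : forall l, 0 <= q l <= 1.
Hypothesis ltr_q : forall l l', l < l' -> q l < q l'.
Hypothesis C_gt0 : 0 < C.
Hypothesis q_fail : forall l, 1 - q l <= C * expR (- l).
Hypothesis eps_gt0 : 0 < eps.

(** From fixed parameters to a supremum over [l >= mu + eps].  On a grid of mesh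
    [1 / K] the likelihood loses at most a factor [expR 1] between neighbours, so
    [prob_likelihood_exceeds] and a union bound deal with the part of the
    half-line covered by the grid.  Past the grid, data that contain a failure
    have likelihood at most [1 - q l <= C * expR (- l)], which is below
    [expR (- 2 * K)]; and [p mu] is above this value except on a set of
    probability at most [2 ^ K * expR (- 2 * K)].  A grid of order [K ^ 2] points
    suffices. *)
Lemma prob_exceeds_above : exists A r, [/\ 0 <= A, 0 < r < 1 &
  forall (D : finType) (N K : nat) (x : D -> 'I_N -> bool) (p : R -> D -> R),
  (0 < N <= K)%N -> (#|D| <= 2 ^ K)%N -> subset_model K x q p ->
  \sum_(b | exceeds_above p mu eps b) p mu b <= A * K%:R ^+ 2 * r ^+ N].
Proof.
pose delta := (q (mu + eps) - q mu) / 2.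
have q_lt : q mu < q (mu + eps) by apply: ltr_q; rewrite ltrDl.
have /andP[ql0 ql1] := q01 mu; have /andP[ql'0 ql'1] := q01 (mu + eps).
have d01 : 0 < delta <= 1 by rewrite /delta; lra.
pose rho := 1 - delta ^+ 2 / 8.
have /andP[rho0 rho1] : 0 < rho < 1 by rewrite /rho; nra.
pose r := Num.max (q mu) (Num.max (expR (-1)) rho).
have r0 : 0 < r by rewrite !lt_max expR_gt0 orbT.
have r1 : r < 1.
  have e1 : expR (-1) < 1 :> R by rewrite expR_lt1 ltrN10.
  by rewrite !gt_max rho1 e1 (lt_le_trans q_lt).
have q_r : q mu <= r by rewrite le_max lexx.
have e_r : expR (-1) <= r by rewrite /r !le_max lexx orbT.
have rho_r : rho <= r by rewrite /r !le_max lexx !orbT.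
(* Beyond [mu + eps + 2 * K + c0] one has [C * expR (- l) < expR (- 2 * K)]. *)
pose c0 := (Num.truncn (ln C - mu - eps)).+1.
have hc0 : ln C - mu - eps < c0%:R by exact: truncnS_gt.
pose e : R := expR 1.
have e2 : 2 <= e by rewrite /e; have := expR_ge1Dx (1 : R); lra.
exists (2 + (2 + c0%:R) * (2 * e)), r; split; [|by rewrite r0 r1|].
  by rewrite addr_ge0// !mulr_ge0// ?addr_ge0//; lra.
move=> D N K x p /andP[N0 NK] DK M; have p0 := likelihood_ge0 M.
have K0 : (0 < K)%N by exact: leq_trans NK.
have KR : 1 <= K%:R :> R by rewrite ler1n.
have KR0 : 0 < K%:R :> R by rewrite ltr0n.
pose J := (K * (2 * K + c0))%N.
pose grid (j : 'I_J) : R := mu + eps + j%:R / K%:R.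
pose small b := p mu b <= expR (- (2 * K%:R)).
pose ones b := [forall i, x b i].
pose beats j b := p mu b <= e * p (grid j) b.
have cover b : exceeds_above p mu eps b ->
    [|| small b, ones b | [exists j, beats j b]].
  move=> /asboolP[l hl pl].
  have [//|big] := boolP (small b); have [//|/forallPn[i /negbTE xi]] := boolP (ones b).
  apply/existsP; rewrite /small -ltNge in big.
  pose j0 := Num.truncn (K%:R * (l - (mu + eps))).
  have l0 : 0 <= K%:R * (l - (mu + eps)) by rewrite mulr_ge0 ?subr_ge0// ltW.
  have /andP[j0l lj0] := truncn_itv l0; rewrite -/j0 in j0l lj0.
  have j0J : (j0 < J)%N.
    rewrite ltnNge; apply/negP => Jj0.
    have hJ : mu + eps + (2 * K%:R + c0%:R) <= l.
      rewrite -lerBrDl -(ler_pM2l KR0); apply: le_trans j0l.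
      by move: Jj0; rewrite -(ler_nat R) /J natrM natrD natrM.
    have := lt_le_trans big (le_trans pl (likelihood_le_failure M l xi)).
    move=> /lt_le_trans /(_ (q_fail l)).
    by rewrite -{1}[C]lnK ?posrE// -expRD ltr_expR; lra.
  exists (Ordinal j0J); rewrite /beats; apply: (le_trans pl).
  apply: (le_trans (likelihood_shift M (grid (Ordinal j0J)) l b)).
  rewrite ler_wpM2r// ler_expR -[X in X * _]ger0_norm ?ltW// -normrM.
  rewrite /grid/= (_ : _ * _ = K%:R * (l - (mu + eps)) - j0%:R); last first.
    by field; rewrite gt_eqF.
  by rewrite ger0_norm ?subr_ge0 // ltrBlDr nat1r.
apply: (le_trans (sum_le_union (p0 mu) cover)).
have Hsmall : \sum_(b | small b) p mu b <= r ^+ N.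
  apply: (le_trans (prob_small_likelihood p mu (expR_ge0 _))).
  have : #|D|%:R <= e ^+ K.
    apply: (@le_trans _ _ (2 ^ K)%:R); first by rewrite ler_nat.
    by rewrite natrX lerXn2r ?nnegrE//; lra.
  move=> /(ler_wpM2r (expR_ge0 (- (2 * K%:R)))) /le_trans; apply.
  rewrite /e -expRM_natl -expRD.
  have -> : expR (K%:R * 1 - 2 * K%:R) = expR (-1) ^+ K :> R.
    by rewrite -expRM_natl; congr expR; ring.
  apply: (@le_trans _ _ (expR (-1) ^+ N)).
    by rewrite ler_wiXn2l ?expR_ge0// expR_le1 lerN10.
  by rewrite lerXn2r ?nnegrE ?expR_ge0// ltW.
have Hones : \sum_(b | ones b) p mu b <= r ^+ N.
  by rewrite /ones (prob_all_success M) lerXn2r ?nnegrE// ltW.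
have Hbeats : \sum_j \sum_(b | beats j b) p mu b <= J%:R * (2 * e * r ^+ N).
  rewrite -[J in leRHS]card_ord -sum1_card natr_sum mulr_suml.
  apply: ler_sum => j _; rewrite mul1r.
  apply: (le_trans (prob_likelihood_exceeds q01 M d01 _ _)); last 2 first.
  - lra.
  - rewrite ler_pM2l; last lra.
    by rewrite lerXn2r ?nnegrE// ltW.
  - rewrite /delta mulrC divfK// addrC subrK.
    have : mu + eps <= grid j by rewrite lerDl divr_ge0// ltW.
    by rewrite le_eqVlt => /orP[/eqP ->//|/ltr_q/ltW].
apply: (le_trans (lerD (lerD Hsmall Hones) Hbeats)).
have rN0 : 0 <= r ^+ N by rewrite exprn_ge0 ?ltW.
have -> : r ^+ N + r ^+ N + J%:R * (2 * e * r ^+ N) =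
  (2 + J%:R * (2 * e)) * r ^+ N by ring.
rewrite ler_wpM2r//.
have HJ : J%:R <= (2 + c0%:R) * K%:R ^+ 2 :> R.
  have hK : K%:R <= K%:R ^+ 2 :> R by rewrite expr2 ler_peMr// ltW.
  have := ler_wpM2l (ler0n R c0) hK.
  by rewrite /J natrM natrD natrM !mulrDl mulrDr; lra.
have K2 : 1 <= K%:R ^+ 2 :> R by rewrite exprn_ege1.
have e0 : 0 <= 2 * e by lra.
have := ler_wpM2r e0 HJ; nra.
Qed.

End tail.

(** Exchanging successes and failures reflects the parameter, which reduces the
    parameters below [mu] to those above. *)
Lemma subset_model_flip (R : realType) (D : finType) (N K : nat)
    (x : D -> 'I_N -> bool) (q : R -> R) (p : R -> D -> R) :
  subset_model K x q p ->
  subset_model K (fun b i => ~~ x b i) (fun l => 1 - q (- l))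
    (fun l => p (- l)).
Proof.
move=> M; split=> [l b|l l' b|l phi phi0].
- exact: likelihood_ge0 M _ _.
- have <- : `|- l' - - l| = `|l' - l| by rewrite -opprD normrN.
  exact: likelihood_shift M _ _ _.
- have := likelihood_weight M (- l)
    (phi := fun i c => phi i (~~ c)) (fun i c => phi0 i _).
  by move=> ->; apply: eq_bigr => i _ /=; ring.
Qed.

Lemma continuous_likelihood (R : realType) (D : finType) (N K : nat)
    (x : D -> 'I_N -> bool) (q : R -> R) (p : R -> D -> R) (b : D) :
  subset_model K x q p -> continuous (p ^~ b).
Proof.
move=> M l.
have cexp (s : R) : expR (s * `|t - l|) * p l b @[t --> l] --> p l b.
  rewrite -[X in _ --> X](_ : expR (s * `|l - l|) * p l b = _); last first.
    by rewrite subrr normr0 mulr0 expR0 mul1r.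
  apply: cvgM; last exact: cvg_cst.
  apply: (cvg_comp _ expR); last exact: continuous_expR.
  apply: cvgM; first exact: cvg_cst.
  apply: (@cvg_norm _ R^o); apply: (@cvgB _ R^o); [exact: cvg_id|exact: cvg_cst].
apply: (squeeze_cvgr _ (cexp (- K%:R)) (cexp K%:R)).
near=> t; apply/andP; split; last exact: likelihood_shift M _ _ _.
rewrite mulNr expRN ler_pdivrMl ?expR_gt0// distrC.
exact: likelihood_shift M _ _ _.
Unshelve. all: by end_near. Qed.

(** If no parameter at distance [eps] or more does as well as [mu], a maximum over
    the compact interval around [mu] is global, so that a global maximizer exists
    and the estimator has to be one. *)
Lemma MLE_near (R : realType) (D : finType) (N K : nat)
    (x : D -> 'I_N -> bool) (q : R -> R) (p : R -> D -> R) (est : D -> R)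
    (mu eps : R) (b : D) :
  subset_model K x q p -> is_MLE p est -> 0 < eps ->
  ~~ exceeds_above p mu eps b ->
  ~~ exceeds_above (fun l => p (- l)) (- mu) eps b ->
  `|est b - mu| < eps.
Proof.
move=> M mle eps0 /asboolPn above /asboolPn below.
have far l : eps <= `|l - mu| -> p l b < p mu b.
  rewrite ler_normr => /orP[hl|hl]; rewrite ltNge; apply/negP => hp.
    by apply: above; exists l => //; rewrite addrC -lerBrDr.
  apply: below; exists (- l); last by rewrite !opprK.
  by rewrite addrC -lerBrDr opprK addrC -opprB.
rewrite ltNge; apply/negP => /far; apply/negP; rewrite -leNgt.
apply: mle; have ab : mu - eps <= mu + eps by lra.
have [c _ cmax] := EVT_max ab (continuous_subspaceT (continuous_likelihood (b := b) M)).
exists c => l; have [hl|hl] := leP eps `|l - mu|; last first.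
  by apply: cmax; rewrite in_itv/= -ler_distl ltW.
apply: (le_trans (ltW (far l hl))); apply: cmax.
by rewrite in_itv/=; apply/andP; split; lra.
Qed.

Section error.
Context (R : realType) (q : R -> R) (C mu eps : R).
Hypothesis q01 : forall l, 0 <= q l <= 1.
Hypothesis ltr_q : forall l l', l < l' -> q l < q l'.
Hypothesis C_gt0 : 0 < C.
Hypothesis q_succ : forall l, q l <= C * expR l.
Hypothesis q_fail : forall l, 1 - q l <= C * expR (- l).
Hypothesis eps_gt0 : 0 < eps.

Lemma MLE_error_bound : exists A r, [/\ 0 <= A, 0 < r < 1 &
  forall (D : finType) (N K : nat) (x : D -> 'I_N -> bool) (p : R -> D -> R)
    (est : D -> R),
  (0 < N <= K)%N -> (#|D| <= 2 ^ K)%N -> subset_model K x q p ->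
  is_MLE p est ->
  \sum_(b | eps <= `|est b - mu|) p mu b <= A * K%:R ^+ 2 * r ^+ N].
Proof.
have [A1 [r1 [A10 /andP[r10 r11] H1]]] :=
  prob_exceeds_above mu q01 ltr_q C_gt0 q_fail eps_gt0.
have [|l l' ll'||A2 [r2 [A20 /andP[r20 r21] H2]]] :=
  @prob_exceeds_above _ (fun l => 1 - q (- l)) C (- mu) eps _ _ C_gt0 _ eps_gt0.
- by move=> l; have := q01 (- l); lra.
- by rewrite ltrD2l ltrN2 ltr_q// ltrN2.
- by move=> l; rewrite opprB addrC subrK.
exists (A1 + A2), (Num.max r1 r2); split; first exact: addr_ge0.
  by rewrite lt_max r10 gt_max r11.
move=> D N K x p est NK DK M mle.
have p0 := likelihood_ge0 M mu.
have := H2 _ _ _ _ _ NK DK (subset_model_flip M); rewrite opprK => {}H2.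
have := H1 _ _ _ _ _ NK DK M => {}H1.
apply: (@le_trans _ _ (\sum_(b | exceeds_above p mu eps b) p mu b +
   \sum_(b | exceeds_above (fun l => p (- l)) (- mu) eps b) p mu b)).
  rewrite [leLHS]big_mkcond [X in _ <= X + _]big_mkcond.
  rewrite [X in _ <= _ + X]big_mkcond -big_split/=.
  apply: ler_sum => b _; case: ifPn => [hb|_]; last first.
    by rewrite addr_ge0//; case: ifP.
  have [_|h1] := ifPn (exceeds_above p mu eps b).
    by rewrite lerDl; case: ifP.
  have [_|h2] := ifPn (exceeds_above (fun l => p (- l)) (- mu) eps b).
    by rewrite add0r.
  by have := MLE_near M mle eps_gt0 h1 h2; rewrite ltNge hb.
have K20 : 0 <= K%:R ^+ 2 :> R by rewrite exprn_ge0.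
have max0 : 0 <= Num.max r1 r2 by rewrite le_max ltW.
have r1r : r1 ^+ N <= Num.max r1 r2 ^+ N.
  by apply: lerXn2r; rewrite ?nnegrE ?(ltW r10)// le_max lexx.
have r2r : r2 ^+ N <= Num.max r1 r2 ^+ N.
  by apply: lerXn2r; rewrite ?nnegrE ?(ltW r20)// le_max lexx orbT.
rewrite !mulrDl; apply: lerD.
  by apply: (le_trans H1); apply: ler_wpM2l => //; exact: mulr_ge0.
by apply: (le_trans H2); apply: ler_wpM2l => //; exact: mulr_ge0.
Qed.

End error.

(** * The crossed logistic model *)

Section diagonal.
Context (R : comNzRingType) (m n : nat).

Definition diag (k : 'I_(minn m n)) : 'I_m * 'I_n :=
  (widen_ord (geq_minl m n) k, widen_ord (geq_minr m n) k).

Lemma diag_inj : injective diag.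
Proof. by move=> k k' [] kk' _; apply: val_inj. Qed.

Lemma sum_matrix_prod (f : 'I_m * 'I_n -> bool -> R) :
  \sum_(b : 'M[bool]_(m, n)) \prod_ij f ij (b ij.1 ij.2) =
  \prod_ij \sum_c f ij c.
Proof.
rewrite bigA_distr_bigA.
rewrite (reindex (fun h : {ffun 'I_m * 'I_n -> bool} => \matrix_(i, j) h (i, j)))/=.
  by apply: eq_bigr => h _; apply: eq_bigr => -[i j] _; rewrite mxE.
exists (fun b : 'M[bool]_(m, n) => [ffun ij => b ij.1 ij.2]) => [h _|b _].
  by apply/ffunP => -[i j]; rewrite ffunE mxE.
by apply/matrixP => i j; rewrite mxE ffunE.
Qed.

(** If each entry of a random 0-1 matrix is drawn with weights [f ij] of total
    mass 1, the entries off the diagonal integrate out. *)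
Lemma sum_matrix_prod_diag (f : 'I_m * 'I_n -> bool -> R)
    (phi : 'I_(minn m n) -> bool -> R) :
  (forall ij, \sum_c f ij c = 1) ->
  \sum_(b : 'M[bool]_(m, n)) (\prod_ij f ij (b ij.1 ij.2)) *
    (\prod_k phi k (b (diag k).1 (diag k).2)) =
  \prod_k \sum_c f (diag k) c * phi k c.
Proof.
move=> f1; pose psi ij c := \prod_k (if diag k == ij then phi k c else 1).
have psi_diag k c : psi (diag k) c = phi k c.
  rewrite /psi (bigD1 k)//= eqxx big1 ?mulr1// => k' /negPf k'k.
  by rewrite (inj_eq diag_inj) k'k.
transitivity (\sum_(b : 'M[bool]_(m, n)) \prod_ij
    (f ij (b ij.1 ij.2) * psi ij (b ij.1 ij.2))).
  apply: eq_bigr => b _; rewrite big_split/=; congr (_ * _).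
  rewrite /psi exchange_big/=; apply: eq_bigr => k _.
  rewrite (bigD1 (diag k))//= eqxx big1 ?mulr1// => ij /negPf.
  by rewrite eq_sym => ->.
rewrite (sum_matrix_prod (fun ij c => f ij c * psi ij c)).
rewrite (bigID (mem [set diag k | k : 'I_(minn m n)]%SET))/=.
rewrite [X in _ * X]big1 ?mulr1 => [|ij nij].
  rewrite big_imset/=; last by move=> k k' _ _; exact: diag_inj.
  by apply: eq_bigr => k _; apply: eq_bigr => c _; rewrite psi_diag.
rewrite -[RHS](f1 ij); apply: eq_bigr => c _; rewrite /psi big1 ?mulr1// => k _.
by case: eqP => // kij; case/negP: nij; rewrite -kij; apply: imset_f.
Qed.

End diagonal.

Lemma normal_pair_rect (R : realType) (A B : set R) :
  measurable A -> measurable B ->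
  normal_pair (A `*` B) = (std_normal A * std_normal B)%E.
Proof.
move=> mA mB.
exact: (@product_measure1E _ _ _ _ _ (@std_normal R) (@std_normal R)).
Qed.

Lemma cond_prob_versionC (d : measure_display) (R : realType)
    (T : measurableType d) (P : probability T R) (G : set (set T))
    (A : set T) (g : T -> R) :
  G `<=` measurable -> measurable A -> (forall w, 0 <= g w <= 1) ->
  cond_prob_version P G A g -> cond_prob_version P G (~` A) (fun w => 1 - g w).
Proof.
move=> GM mA g01 [mg ig Pg].
have mg' : measurable_fun setT g.
  by move=> _ B mB; rewrite setTI; apply: GM; exact: mg.
have m1g : measurable_fun setT (fun w => 1 - g w) by exact: measurable_funB.
split => [B mB||E GE].
- rewrite -[X in G X]/(g @^-1` ((fun t : R => 1 - t) @^-1` B)).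
  apply: mg; rewrite -[X in measurable X]setTI.
  have m1 : measurable_fun setT (fun t : R => 1 - t) by exact: measurable_funB.
  exact: m1.
- have -> : EFin \o (fun w => 1 - g w) = (cst 1%E \- (EFin \o g))%E.
    by apply/funext => w /=; rewrite EFinB.
  by apply: integrableB => //; exact: (finite_measure_integrable_cst P 1).
have mE := GM _ GE.
have : (\int[P]_(w in E) ((1 - g w)%:E + (g w)%:E) = P E)%E.
  rewrite -[RHS]mul1e -integral_cst//.
  by apply: eq_integral => w _; rewrite -EFinD subrK.
rewrite ge0_integralD//; last 4 first.
- by move=> w _; rewrite lee_fin subr_ge0; case/andP: (g01 w).
- by apply: measurable_funTS; apply/measurable_EFinP.
- by move=> w _; rewrite lee_fin; case/andP: (g01 w).
- by apply: measurable_funTS; apply/measurable_EFinP.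
rewrite Pg// => PE.
have : P (~` A `&` E) + P (A `&` E) = P E :> \bar R.
  rewrite -measureU//; last 3 first.
  - by apply: measurableI => //; exact: measurableC.
  - exact: measurableI.
  - by rewrite setIACA setICl set0I.
  by rewrite -setIUl setUCl setTI.
rewrite -PE => /eqP.
rewrite eq_sym => /eqP h.
have fA : P (A `&` E) \is a fin_num by apply: fin_num_measure; exact: measurableI.
by rewrite -[LHS](@addeK _ (P (A `&` E)))// h addeK.
Qed.

Section model.
Context (d : measure_display) (R : realType) (T : measurableType d) (m n : nat).
Context (P : R -> probability T R).
Context (u : 'I_m -> {mfun T >-> R}) (v : 'I_n -> {mfun T >-> R}).
Context (y : 'I_m -> 'I_n -> {mfun T >-> bool}).
Hypothesis model : forall l, crossed_logistic_model (P l) l u v y.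

Local Notation uv := (random_effects u v).
Local Notation G := (sigma_generated uv).

Definition response_weight (c : bool) (z : R) : R :=
  if c then expit z else 1 - expit z.

Lemma response_weight01 c z : 0 <= response_weight c z <= 1.
Proof.
have := expit_gt0 z; have := expit_lt1 z.
by rewrite /response_weight; case: c; lra.
Qed.

Lemma response_weight_shift c z z' :
  response_weight c z' <= expR `|z' - z| * response_weight c z.
Proof.
rewrite /response_weight; case: c; first exact: expit_le_shift.
rewrite -!expitN; have <- : `|- z' - - z| = `|z' - z| by rewrite -opprD normrN.
exact: expit_le_shift.
Qed.

(** The conditional probability of the data [b] given the random effects. *)
Definition cond_likelihood (l : R) (b : 'M[bool]_(m, n)) (w : T) : R :=
  \prod_(ij : 'I_m * 'I_n) response_weight (b ij.1 ij.2) (l + u ij.1 w + v ij.2 w).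

Lemma sigma_generated_measurable : G `<=` measurable.
Proof.
apply: smallest_sub; first exact: sigma_algebra_measurable.
move=> _ [s _ [B mB <-]]; rewrite setTI -[X in measurable X]setTI.
exact: measurable_funPT.
Qed.

Let GT : G setT.
Proof. by apply: (@measurableT _ (g_sigma_algebraType _)). Qed.

Lemma responses_preimage b :
  responses y @^-1` [set b] =
  \bigcap_(ij in [set: 'I_m * 'I_n]) y ij.1 ij.2 @^-1` [set b ij.1 ij.2].
Proof.
apply/seteqP; split => w /=.
  by move=> <- ij _ /=; rewrite mxE.
move=> h; apply/matrixP => i j; rewrite mxE; exact: (h (i, j) I).
Qed.

Lemma measurable_responses b : measurable (responses y @^-1` [set b]).
Proof.
rewrite responses_preimage; apply: fin_bigcap_measurable => // ij _.
by rewrite -[X in measurable X]setTI; exact: measurable_funPT.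
Qed.

Lemma cond_likelihood_version l b :
  cond_prob_version (P l) G (responses y @^-1` [set b]) (cond_likelihood l b).
Proof.
have [_ _ ci yq] := model l; rewrite responses_preimage.
apply: (ci (fun ij => [set b ij.1 ij.2])
  (fun ij w => response_weight (b ij.1 ij.2) (l + u ij.1 w + v ij.2 w))) => //.
move=> [i j] /=; have [q cq qE] := yq i j.
have qexp : q = fun w => expit (l + u i w + v j w).
  by apply/funext => w; have [q01 lq] := qE w; exact: logitK q01 lq.
rewrite /response_weight; case: (b i j); first by rewrite -qexp.
have -> : y i j @^-1` [set false] = ~` (y i j @^-1` [set true]).
  by apply/seteqP; split => w /=; case: (y i j w).
have -> : (fun w => 1 - expit (l + u i w + v j w)) = (fun w => 1 - q w).
  by rewrite qexp.
apply: cond_prob_versionC => //; first exact: sigma_generated_measurable.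
  by rewrite -[X in measurable X]setTI; exact: measurable_funPT.
by move=> w; have [/andP[q0 q1] _] := qE w; rewrite !ltW.
Qed.

Lemma cond_likelihood_ge0 l b w : 0 <= cond_likelihood l b w.
Proof.
apply: prodr_ge0 => ij _.
by have /andP[] := response_weight01 (b ij.1 ij.2) (l + u ij.1 w + v ij.2 w).
Qed.

Lemma response_pmfE l b :
  (response_pmf (P l) y b)%:E = (\int[P l]_w (cond_likelihood l b w)%:E)%E.
Proof.
have [_ _ ->//] := cond_likelihood_version l b.
rewrite setIT fineK// fin_num_measure//; exact: measurable_responses.
Qed.

(** The model fixes the law of the random effects whatever the parameter, first
    on the events that are intersections of conditions on each effect, then on
    the sigma-algebra that they generate. *)
Lemma random_effects_law_unique l l' E : G E -> P l E = P l' E.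
Proof.
pose G0 := [set X | exists2 A : 'I_m + 'I_n -> set R,
  forall s, measurable (A s) & X = \bigcap_(s in [set: 'I_m + 'I_n]) uv s @^-1` A s].
have muv s (A : set R) : measurable A -> measurable (uv s @^-1` A).
  by move=> mA; rewrite -[X in measurable X]setTI; exact: measurable_funPT.
have G0T : G0 setT.
  by exists (fun=> setT) => //; apply/seteqP; split => // w _ s.
move=> GE; apply: (@g_sigma_algebra_measure_unique _ _ _ G0 _ (fun=> setT)) => //.
- move=> _ [A mA ->]; apply: fin_bigcap_measurable => // s _; exact: muv.
- by rewrite bigcup_const//; exists 0%N.
- move=> _ _ [A mA ->] [B mB ->]; exists (fun s => A s `&` B s).
    by move=> s; exact: measurableI.
  by rewrite -bigcapI.
- move=> _ [A mA ->].
  have [h1 ind1 _ _] := model l; have [h2 ind2 _ _] := model l'.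
  apply: (etrans (ind1 A mA)); apply: (etrans _ (esym (ind2 A mA))).
  by apply: eq_bigr => s _; rewrite h1// h2.
- by move=> k; rewrite (@le_lt_trans _ _ 1%E)// ?ltry// probability_le1.
- apply: (smallest_sub _ _ GE); first exact: smallest_sigma_algebra.
  move=> _ [s _ [B mB <-]]; apply: sub_sigma_algebra.
  exists (fun s' => if s' == s then B else setT); first by move=> s'; case: ifP.
  rewrite setTI; apply/seteqP; split => [w Bw s' _|w /(_ s I)] /=.
    by case: eqP => // ->.
  by rewrite eqxx.
Qed.

(** The conditional likelihood is a function of the random effects, so it may be
    averaged under the law of any parameter [l'].  This makes the marginal
    likelihoods of different parameters comparable. *)
Lemma response_pmf_change_law l l' b :
  (response_pmf (P l) y b)%:E = (\int[P l']_w (cond_likelihood l b w)%:E)%E.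
Proof.
rewrite response_pmfE; have [mF _ _] := cond_likelihood_version l b.
have mF' : measurable_fun setT (cond_likelihood l b).
  move=> _ B mB; rewrite setTI; apply: sigma_generated_measurable.
  exact: mF.
have mabs : measurable_fun setT (fun t : R => `|t|%:E).
  by apply/measurable_EFinP; exact: normr_measurable.
(* The integral depends only on the law of the conditional likelihood; the
   absolute value makes the integrand nonnegative on all of [R]. *)
have E l1 : (\int[P l1]_w (cond_likelihood l b w)%:E =
    \int[pushforward (P l1) (cond_likelihood l b)]_t `|t|%:E)%E.
  rewrite ge0_integral_pushforward//; apply: eq_integral => w _ /=.
  by rewrite ger0_norm// cond_likelihood_ge0.
rewrite !E; apply: eq_measure_integral => A mA _; rewrite /pushforward.
by apply: random_effects_law_unique; exact: mF.
Qed.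

Local Notation N := (minn m n).

Definition effect_pair (k : 'I_N) (w : T) : R * R :=
  (u (diag k).1 w, v (diag k).2 w).

Lemma measurable_effect_pair k : measurable_fun setT (effect_pair k).
Proof. exact: measurable_fun_pair. Qed.

(* Conditions on the first [N] effects, completed by trivial ones. *)
Let extend (A : 'I_N -> set R) (i : nat) : set R :=
  if (insub i : option 'I_N) is Some k then A k else setT.

Let extendE A (k : 'I_N) : extend A k = A k.
Proof. by rewrite /extend valK. Qed.

Let extendT A i : (i < N)%N = false -> extend A i = setT.
Proof. by rewrite /extend; case: insubP => // k ->. Qed.

Let measurable_extend A i : (forall k, measurable (A k)) -> measurable (extend A i).
Proof. by rewrite /extend; case: insub. Qed.

Let prod_extend A q : (N <= q)%N ->
  (\prod_(i < q) std_normal (extend A i) = \prod_(k < N) std_normal (A k))%E.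
Proof.
move=> Nq; rewrite (bigID (fun i : 'I_q => (i < N)%N))/=.
rewrite [X in (_ * X)%E]big1 => [|i /negbTE iN]; last first.
  by rewrite extendT//; exact: probability_setT.
rewrite mule1 -(big_ord_widen q (fun i => std_normal (extend A i)) Nq).
by apply: eq_bigr => k _; rewrite extendE.
Qed.

Let rectangles : set (set (R * R)) := [set A `*` B | A in measurable & B in measurable].

(** Distinct diagonal entries share no random effect. *)
Lemma effect_pair_indep l (C : 'I_N -> set (R * R)) :
  (forall k, rectangles (C k)) ->
  P l (\bigcap_(k in [set: 'I_N]) effect_pair k @^-1` C k) =
  (\prod_k normal_pair (C k))%E.
Proof.
move=> rC.
have [A hA] : {A : 'I_N -> set R & forall k, measurable (A k) /\
    exists2 B, measurable B & A k `*` B = C k}.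
  apply: (@choice 'I_N (set R) (fun k A => measurable A /\
    exists2 B, measurable B & A `*` B = C k)) => k.
  by have [A mA hB] := rC k; exists A.
have [B hB] : {B : 'I_N -> set R & forall k, measurable (B k) /\ A k `*` B k = C k}.
  apply: (@choice 'I_N (set R) (fun k B => measurable B /\ A k `*` B = C k)) => k.
  by have [_ [B mB hB]] := hA k; exists B.
pose F (s : 'I_m + 'I_n) := match s with
  inl i => extend A i | inr j => extend B j end.
have mF s : measurable (F s).
  by case: s => i; apply: measurable_extend => k; [have [] := hA k|have [] := hB k].
have -> : \bigcap_(k in [set: 'I_N]) effect_pair k @^-1` C k =
    \bigcap_(s in [set: 'I_m + 'I_n]) uv s @^-1` F s.
  apply/seteqP; split => w h.
    move=> [i|j] _ /=; rewrite /extend; case: insubP => // k _ ki.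
      have := h k I; have [_ <-] := hB k; rewrite /effect_pair /= => -[].
      by rewrite (_ : widen_ord _ k = i)//; exact: val_inj.
    have := h k I; have [_ <-] := hB k; rewrite /effect_pair /= => -[_].
    by rewrite (_ : widen_ord _ k = j)//; exact: val_inj.
  move=> k _; have [_ <-] := hB k; split => /=.
    by have := h (inl (diag k).1) I; rewrite /= extendE.
  by have := h (inr (diag k).2) I; rewrite /= extendE.
have [law ind _ _] := model l.
rewrite ind// big_sumType/=.
transitivity ((\prod_(i < m) std_normal (extend A i)) *
   (\prod_(j < n) std_normal (extend B j)))%E.
  congr (_ * _)%E; apply: eq_bigr => i _.
    by apply: (law (inl i)); exact: (mF (inl i)).
  by apply: (law (inr i)); exact: (mF (inr i)).
rewrite prod_extend ?geq_minl// prod_extend ?geq_minr// -big_split/=.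
apply: eq_bigr => k _; have [mB <-] := hB k; have [mA _] := hA k.
by rewrite normal_pair_rect.
Qed.

Lemma expectation_prod_pairs l (psi : 'I_N -> R * R -> R) (a : 'I_N -> R) :
  (forall k, measurable_fun setT (psi k)) -> (forall k z, 0 <= psi k z) ->
  (forall k, (\int[@normal_pair R]_z (psi k z)%:E)%E = (a k)%:E) ->
  (\int[P l]_w (\prod_k psi k (effect_pair k w))%:E)%E = (\prod_k a k)%:E.
Proof.
apply: (@expectation_prod_independent _ _ _ _ _ _ _ rectangles).
- exact: measurable_prod_measurableType.
- move=> _ _ [A mA [B mB <-]] [A' mA' [B' mB' <-]].
  exists (A `&` A'); first exact: measurableI.
  by exists (B `&` B'); [exact: measurableI|rewrite setXI].
- by exists setT => //; exists setT => //; rewrite setXTT.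
- exact: measurable_effect_pair.
- exact: effect_pair_indep.
Qed.

Lemma measurable_response_weight (c : bool) :
  measurable_fun setT (response_weight c).
Proof.
case: c; first exact: measurable_expit.
by apply: measurable_funB => //; exact: measurable_expit.
Qed.

Lemma measurable_cond_likelihood l b :
  measurable_fun setT (cond_likelihood l b).
Proof.
apply: measurable_prod => ij _; apply: measurableT_comp.
  exact: measurable_response_weight.
by apply: measurable_funD => //; apply: measurable_funD.
Qed.

Let measurable_cond_likelihood_EFin l b :
  measurable_fun setT (fun w => (cond_likelihood l b w)%:E).
Proof. by apply/measurable_EFinP; exact: measurable_cond_likelihood. Qed.

Let cond_likelihood_ge0_EFin l b w : (0 <= (cond_likelihood l b w)%:E)%E.
Proof. by rewrite lee_fin cond_likelihood_ge0. Qed.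

Lemma cond_likelihood_shift l l' b w :
  cond_likelihood l' b w <=
  expR ((m * n)%:R * `|l' - l|) * cond_likelihood l b w.
Proof.
have -> : (m * n)%N = #|{: 'I_m * 'I_n}| by rewrite card_prod !card_ord.
rewrite expRM_natl -prodr_const.
rewrite -big_split/=; apply: ler_prod => ij _.
apply/andP; split.
  by have /andP[] := response_weight01 (b ij.1 ij.2) (l' + u ij.1 w + v ij.2 w).
have -> : l' - l = (l' + u ij.1 w + v ij.2 w) - (l + u ij.1 w + v ij.2 w) by ring.
exact: response_weight_shift.
Qed.

(** Given the random effects the responses are independent, and their weights
    off the diagonal sum to 1; what remains is a product over [k] of functions
    of the independent pairs [(u k, v k)]. *)
Lemma response_pmf_weight l (phi : 'I_(minn m n) -> bool -> R) :
  (forall i c, 0 <= phi i c) ->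
  \sum_b response_pmf (P l) y b *
    \prod_k phi k (b (diag k).1 (diag k).2) =
  \prod_k (success_prob l * phi k true + (1 - success_prob l) * phi k false).
Proof.
move=> phi0; apply: EFin_inj.
pose psi k (z : R * R) := expit (l + z.1 + z.2) * phi k true +
  (1 - expit (l + z.1 + z.2)) * phi k false.
rewrite -(expectation_prod_pairs l (psi := psi)); last 3 first.
- move=> k; apply: measurable_funD; apply: measurable_funM => //.
    exact: measurable_expit_shift.
  by apply: measurable_funB => //; exact: measurable_expit_shift.
- move=> k z; have := expit_gt0 (l + z.1 + z.2); have := expit_lt1 (l + z.1 + z.2).
  by move=> h1 h0; rewrite addr_ge0// mulr_ge0// ?subr_ge0 ltW.
- by move=> k; rewrite integral_response_weight.
have Phi0 (b : 'M[bool]_(m, n)) : 0 <= \prod_k phi k (b (diag k).1 (diag k).2).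
  exact: prodr_ge0.
have mc b := measurable_cond_likelihood_EFin l b.
have c0 b w := cond_likelihood_ge0_EFin l b w.
rewrite -sumEFin; transitivity (\sum_b (\int[P l]_w ((cond_likelihood l b w)%:E *
    (\prod_k phi k (b (diag k).1 (diag k).2))%:E)))%E.
  by apply: eq_bigr => b _; rewrite EFinM response_pmfE -ge0_integralZr// lee_fin.
rewrite -ge0_integral_sum//; last 2 first.
- by move=> b; apply: emeasurable_funM.
- by move=> b w _; rewrite mule_ge0// lee_fin.
apply: eq_integral => w _.
transitivity (\sum_b (cond_likelihood l b w *
    \prod_k phi k (b (diag k).1 (diag k).2))%:E)%E.
  by apply: eq_bigr => b _; rewrite EFinM.
rewrite sumEFin; congr (_%:E).
rewrite /cond_likelihood (sum_matrix_prod_diag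
  (f := fun ij c => response_weight c (l + u ij.1 w + v ij.2 w))).
  by apply: eq_bigr => k _; rewrite big_bool.
by move=> ij; rewrite big_bool /= subrKC.
Qed.

Lemma crossed_subset_model :
  subset_model (m * n) (fun (b : 'M[bool]_(m, n)) k => b (diag k).1 (diag k).2)
    (@success_prob R) (fun l => response_pmf (P l) y).
Proof.
split=> [l b|l l' b|l phi phi0]; last exact: response_pmf_weight.
  by rewrite fine_ge0// measure_ge0.
rewrite -lee_fin (response_pmf_change_law l' l) EFinM response_pmfE.
rewrite -ge0_integralZl//; apply: ge0_le_integral => //.
- exact: emeasurable_funM.
- by move=> w _; rewrite -EFinM lee_fin cond_likelihood_shift.
Qed.

Lemma prob_responses l (E : pred 'M[bool]_(m, n)) :
  P l [set w | E (responses y w)] =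
  (\sum_(b | E b) response_pmf (P l) y b)%:E.
Proof.
pose F b := responses y @^-1` [set b].
have mF b : measurable (F b) by exact: measurable_responses.
have -> : [set w | E (responses y w)] = \bigcup_(b in [set b | E b]) F b.
  apply/seteqP; split => [w Ew|w [b Eb wb] /=]; first by exists (responses y w).
  by rewrite (wb : responses y w = b).
rewrite measure_fin_bigcup; [|exact: finite_finset| |by []]; last first.
  by move=> b b' _ _ [w [hb hb']]; exact: etrans (esym hb) hb'.
rewrite (_ : [set b | E b] = [set` [seq b <- index_enum _ | E b]]); last first.
  by apply/seteqP; split => b; rewrite /= mem_filter mem_index_enum andbT.
rewrite -fsbig_seq ?filter_uniq ?index_enum_uniq// big_filter -sumEFin.
by apply: eq_bigr => b _; rewrite fineK// fin_num_measure//; exact: mF.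
Qed.

End model.

(** * Asymptotics *)

Lemma cvg_minn (m n : nat -> nat) : m @ \oo --> \oo -> n @ \oo --> \oo ->
  (fun k => minn (m k) (n k)) @ \oo --> \oo.
Proof.
move=> moo noo; apply/cvgnyPge => B.
have /cvgnyPge/(_ B) mB := moo; have /cvgnyPge/(_ B) nB := noo.
by near=> k; rewrite leq_min; apply/andP; split; near: k.
Unshelve. all: by end_near. Qed.

(** When [log (max m n)] is negligible with respect to [min m n], powers of
    [m * n] are absorbed by exponentially small terms in [min m n].  The exponent
    2 is the order of the size of the grid in [prob_exceeds_above]. *)
Lemma rate_dominates (R : realType) (m n : nat -> nat) (A r : R) :
  (forall k, (0 < m k)%N) -> (forall k, (0 < n k)%N) -> 0 <= A -> 0 < r < 1 ->
  (fun k => ln ((maxn (m k) (n k))%:R : R) / (minn (m k) (n k))%:R) @ \oo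
    --> (0 : R) ->
  exists2 s : R, 0 < s < 1 & \forall k \near \oo,
    A * (m k * n k)%:R ^+ 2 * r ^+ minn (m k) (n k) <= A * s ^+ minn (m k) (n k).
Proof.
move=> m0 n0 A0 /andP[r0 r1] rate.
(* [(m * n) ^ 2 <= M ^ 4 <= expR (N * c / 2)] as soon as [ln M <= N * c / 8]. *)
pose c := - ln r; have c0 : 0 < c by rewrite oppr_gt0 ln_lt0// r0.
exists (expR (- (c / 2))).
  by rewrite expR_gt0 expR_lt1 oppr_lt0 divr_gt0.
have c8 : 0 < c / 8 by rewrite divr_gt0.
have small := cvgr_le _ rate _ c8.
near=> k.
have : ln ((maxn (m k) (n k))%:R : R) / (minn (m k) (n k))%:R <= c / 8.
  by near: k; exact: small.
set N := minn _ _; set M := maxn _ _.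
have N0 : 0 < N%:R :> R by rewrite ltr0n /N leq_min m0 n0.
have M0 : 0 < M%:R :> R by rewrite ltr0n /M leq_max m0.
rewrite ler_pdivrMr// => lnM.
rewrite -mulrA ler_wpM2l//.
have mnM : (m k * n k)%:R ^+ 2 <= M%:R ^+ 4 :> R.
  rewrite (_ : 4%N = (2 * 2)%N)// exprM lerXn2r ?nnegrE ?exprn_ge0 ?ler0n//.
  by rewrite expr2 natrM ler_pM ?ler0n// ler_nat /M ?leq_maxl ?leq_maxr.
apply: (@le_trans _ _ (M%:R ^+ 4 * r ^+ N)).
  by rewrite ler_wpM2r// exprn_ge0// ltW.
rewrite -{1}[M%:R]lnK ?posrE// -[X in _ * X ^+ _]lnK ?posrE//.
rewrite -!expRM_natl -expRD ler_expR -/c.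
have -> : ln r = - c by rewrite opprK.
lra.
Unshelve. all: by end_near. Qed.

Theorem theorem2 (R : realType) (mu : R) (m n : nat -> nat)
    (d : nat -> measure_display) (T : forall k, measurableType (d k))
    (P : forall k, R -> probability (T k) R)
    (u : forall k, 'I_(m k) -> {mfun T k >-> R})
    (v : forall k, 'I_(n k) -> {mfun T k >-> R})
    (y : forall k, 'I_(m k) -> 'I_(n k) -> {mfun T k >-> bool})
    (mle : forall k, 'M[bool]_(m k, n k) -> R)
    (m_gt0 : forall k, (0 < m k)%N) (n_gt0 : forall k, (0 < n k)%N)
    (model : forall k (lambda : R),
      crossed_logistic_model (P k lambda) lambda (u k) (v k) (y k))
    (mle_def : forall k,
      is_MLE (fun lambda => response_pmf (P k lambda) (y k)) (mle k))
    (m_infty : m @ \oo --> \oo) (n_infty : n @ \oo --> \oo)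
    (log_rate : (fun k => ln ((maxn (m k) (n k))%:R : R)
                          / (minn (m k) (n k))%:R) @ \oo --> (0 : R)) :
  cvg_in_probability (fun k => P k mu)
    (fun k (w : T k) => mle k (responses (y k) w)) mu.
Proof.
move=> eps eps0.
have q01 (l : R) : 0 <= success_prob l <= 1.
  by rewrite success_prob_ge0 success_prob_le1.
have [A [r [A0 r01 bound]]] := MLE_error_bound mu q01 (@ltr_success_prob R)
  (expR_gt0 1) (@success_prob_le_expR R) (@failure_prob_le_expR R) eps0.
have [s /andP[s0 s1] near_s] := rate_dominates m_gt0 n_gt0 A0 r01 log_rate.
have Pk k : (P k mu [set w | (eps <= `|mle k (responses (y k) w) - mu|)%R] <=
    (A * (m k * n k)%:R ^+ 2 * r ^+ minn (m k) (n k))%:E)%E.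
  rewrite (prob_responses (P k) (y k) mu (fun b => eps <= `|mle k b - mu|)) lee_fin.
  apply: bound (crossed_subset_model (model k)) (mle_def k).
    rewrite leq_min m_gt0 n_gt0/= (leq_trans (geq_minl _ _))//.
    exact: leq_pmulr.
  by rewrite card_mx card_bool.
have sN : A * s ^+ minn (m k) (n k) @[k --> \oo] --> A * 0.
  apply: cvgM; first exact: cvg_cst.
  apply: (cvg_comp _ (fun N => s ^+ N) (cvg_minn m_infty n_infty)).
  by apply: cvg_expr; rewrite ger0_norm// ltW.
have {sN}sN : (A * s ^+ minn (m k) (n k))%:E @[k --> \oo] --> (0 : \bar R)%E.
  rewrite mulr0 in sN; apply: cvg_EFin => //.
  exact: nearW.
apply: (squeeze_cvge _ (cvg_cst 0%E) sN).
near=> k; apply/andP; split; first exact: measure_ge0.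
apply: (le_trans (Pk k)); rewrite lee_fin.
by near: k; exact: near_s.
Unshelve. all: by end_near. Qed.
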